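(* Let $(Z,d)$ be a discrete metric space and suppose that $(Y,\rho)$ is any metric space that contains a nested sequence of open balls $B_1\supset B_2\supset B_3\supset\cdots$ such that (1) the diameter $t_n$ of $B_n$ tends to $0$ as $n\to\infty$, and (2) $|Z|\leq|B_n|$ (cardinalities) for all $n\in\mathbb{N}$. Then $Z$ may be Lipschitz injected into $Y$; that is, there exists an injective Lipschitz map $f:Z\to Y$.
   Context: A metric space $(Z,d)$ is discrete if for each $x\in Z$ there exists $\delta>0$ (depending on $x$) such that $d(x,y)>\delta$ for all $y\neq x$. A map $f:(Z,d)\to(Y,\rho)$ is Lipschitz if there is a constant $K\ge 0$ with $\rho(f(x),f(y))\leq K\,d(x,y)$ for all $x,y\in Z$; no continuity is required of the inverse of a Lipschitz injection. *)

(* Defs.v *)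
From HB Require Import structures.
From mathcomp Require Import all_boot all_order all_algebra.
From mathcomp Require Import all_classical all_reals all_analysis.
Import Order.TTheory GRing.Theory Num.Theory.
Import numFieldNormedType.Exports.

Set Implicit Arguments.
Unset Strict Implicit.
Unset Printing Implicit Defensive.

Local Open Scope classical_set_scope.
Local Open Scope ring_scope.

Definition discrete_metric (R : realType) (Z : metricType R) : Prop :=
  forall x : Z, exists2 delta : R,
    0 < delta & forall y : Z, y <> x -> delta < mdist x y.

Definition open_ball (R : realType) (Y : metricType R) (B : set Y) : Prop :=
  exists (c : Y) (r : R), 0 < r /\ B = ball c r.

(* The value is +oo when A is unbounded, and -oo when A is empty; an
   [open_ball] contains its center, so the latter does not arise for balls. *)
Definition diameter (R : realType) (Y : metricType R) (A : set Y) : \bar R :=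
  ereal_sup [set (mdist x y)%:E | x in A & y in A].

(* The library's [k.-lipschitz f] is restricted to normed modules. *)
Definition lipschitz_map (R : realType) (Z Y : metricType R) (f : Z -> Y) :
    Prop :=
  exists2 K : R, 0 <= K &
    forall x y : Z, mdist (f x) (f y) <= K * mdist x y.

(* Main.v *)
(* If delta_x isolates x, let k(x) be an index with diam B_{k(x)} <= delta_x. Any
   f with f(x) in B_{k(x)} for all x is 1-Lipschitz: of two points x <> y, say
   with k(x) <= k(y), both images lie in B_{k(x)} by nestedness, so
   rho(f x, f y) <= delta_x < d(x, y). Such an f can be made injective by
   transfinite recursion along a well-order of Z whose proper initial segments
   are all smaller than Z: at stage x fewer than |Z| <= |B_{k(x)}| points of
   B_{k(x)} have been used. *)

Require Import Defs.
From HB Require Import structures.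
From mathcomp Require Import all_boot all_order all_algebra.
From mathcomp Require Import all_classical all_reals all_analysis.
From mathcomp Require Import wochoice.
From Stdlib Require Import Wellfounded.
Import Order.TTheory GRing.Theory Num.Theory.
Import numFieldNormedType.Exports.

Set Implicit Arguments.
Unset Strict Implicit.
Unset Printing Implicit Defensive.

Local Open Scope classical_set_scope.
Local Open Scope ring_scope.
Local Open Scope card_scope.

(** Trades injections between subtypes for plain functions, which can be composed and restricted
    directly. *)
Lemma card_le_setTP (X T : Type) (A : set T) :
  reflect (exists2 g : X -> T, injective g & forall x, A (g x))
          ([set: X] #<= A).
Proof.
apply: (iffP card_leP) => [[g]|[g g_inj gA]].
- have xT (x : X) : x \in [set: X] by rewrite in_setT.
  exists (fun x => val (g (SigSub (xT x)))); last first.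
    by move=> x; apply: set_mem; exact: valP.
  move=> x y /val_inj /(inj (f := g)).
  by rewrite !in_setT => /(_ isT isT) [].
- have /card_eqPle[_ le_im] := inj_card_eq (in2W g_inj : set_inj setT g).
  by apply/card_leP/(card_le_trans le_im)/subset_card_le => _ [x _ <-]; exact: gA.
Qed.

(** Take the strict part of a Zermelo well-order: a least non-accessible point would have only
    accessible predecessors, hence be accessible. *)
Lemma ex_well_order (X : Type) : exists lt : X -> X -> Prop,
  well_founded lt /\ forall x y, x <> y -> lt x y \/ lt y x.
Proof.
have [R woR] := well_ordering_principle {classic X}.
have chR : wo_chain R predT by move=> A _; exact: woR.
exists (fun x y => R x y /\ x <> y); split; last first.
  move=> x y xy; have /orP[] := wo_chainW chR (isT : x \in predT) (isT : y \in predT).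
    by left.
  by right; split=> //; exact: nesym.
move=> x; apply: contrapT => nx.
pose N : {pred {classic X}} := fun y => `[< ~ Acc (fun x y => R x y /\ x <> y) y >].
have [|z [[/asboolP Nz minz] _]] := woR N; first by exists x; exact/asboolP.
apply: Nz; constructor=> y [Ryz yz]; apply: contrapT => ny; apply: yz.
apply: (wo_chain_antisymmetric chR) => //.
by rewrite Ryz minz//; exact/asboolP.
Qed.

(* The order type is an initial ordinal: if some initial segment is as large as
   X, pull the order back along an injection of X into the least such one. *)
Lemma ex_initial_well_order (X : Type) : exists lt : X -> X -> Prop,
  [/\ well_founded lt, forall x y, x <> y -> lt x y \/ lt y x
    & forall x, ~ ([set: X] #<= [set y | lt y x])].
Proof.
have [lt [wf_lt tot_lt]] := ex_well_order X.
suff [g g_inj small_g] : exists2 g : X -> X, injective g &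
    forall x, ~ ([set: X] #<= [set y | lt y (g x)]).
  exists (fun x y => lt (g x) (g y)); split=> [|x y xy|x].
  - exact: wf_inverse_image.
  - by apply: tot_lt => /g_inj.
  - move=> /card_le_setTP[h h_inj hx]; apply: (small_g x).
    by apply/card_le_setTP; exists (g \o h) => //; exact: inj_comp.
have [[x0 x0P]|/forallNP] := pselect (exists x, [set: X] #<= [set y | lt y x]);
  last by exists id.
elim/(well_founded_ind wf_lt): x0 x0P => x IH xP.
have [[y yx yP]|noy] := pselect (exists2 y, lt y x & [set: X] #<= [set z | lt z y]).
  exact: IH yP.
move/card_le_setTP: xP => [g g_inj gx]; exists g => // y yP.
by apply: noy; exists (g y); first exact: gx.
Qed.

Lemma injective_selection (X T : Type) (C : X -> set T) :
  (forall x, [set: X] #<= C x) ->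
  exists f : X -> T, injective f /\ forall x, C x (f x).
Proof.
move=> leC; have [lt [wf_lt tot_lt small]] := ex_initial_well_order X.
(* Here [g] records the values chosen below [x]. If they exhausted [C x], picking for each [h z] a
   stage where it was used would inject [X] into the segment below [x], against [small]. *)
have fresh x (g : forall y, lt y x -> T) :
    exists t, C x t /\ forall y (yx : lt y x), g y yx <> t.
  apply: contrapT => no; apply: (small x).
  have cov t : C x t -> exists y, exists yx : lt y x, g y yx = t.
    move=> Ct; apply: contrapT => nt; apply: no; exists t; split=> // y yx gt.
    by apply: nt; exists y, yx.
  have /card_le_setTP[h h_inj hC] := leC x.
  have [k kP] := choice (fun z => cov _ (hC z)).
  apply/card_le_setTP; exists k => [z z' kk|z]; last by have [] := kP z.
  have [yx gz] := kP z; have [yx' gz'] := kP z'.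
  (* [g] also takes a proof of [lt y x], so equal stages give equal values only once these proofs
     are identified. *)
  apply: h_inj; rewrite -gz -gz'; move: (yx) (yx'); rewrite kk => p q.
  by congr g; exact: Prop_irrelevance.
pose F x g := projT1 (cid (fresh x g)).
pose f := Fix wf_lt (fun=> T) F.
have fE x : f x = F x (fun y _ => f y).
  apply: Fix_eq => {}x g g' gg'; congr F.
  by apply/functional_extensionality_dep => y; apply/funext => p.
have fP x : C x (f x) /\ forall y, lt y x -> f y <> f x.
  by rewrite fE /F; case: cid.
exists f; split=> [x y fxy|x]; last by have [] := fP x.
(* Of two distinct points, the later one avoids the value taken at the earlier. *)
apply: contrapT => /tot_lt[xy|yx].
- by have [_ /(_ x xy)] := fP y.
- by have [_ /(_ y yx)] := fP x; rewrite fxy.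
Qed.

Lemma mdist_le_diameter (R : realType) (Y : metricType R) (A : set Y) x y :
  A x -> A y -> ((mdist x y)%:E <= diameter A)%E.
Proof.
by move=> Ax Ay; apply: ereal_sup_ubound; exists x => //; exists y.
Qed.

Theorem theorem4p5 (R : realType) (Z Y : metricType R) (B : nat -> set Y)
    (hZ : discrete_metric Z)
    (hball : forall n : nat, open_ball (B n))
    (hnested : forall n : nat, B n.+1 `<=` B n)
    (hdiam : diameter (B n) @[n --> \oo] --> 0%E)
    (hcard : forall n : nat, [set: Z] #<= B n) :
  exists f : Z -> Y, injective f /\ lipschitz_map f.
Proof.
have nested m n : (m <= n)%N -> B n `<=` B m.
  move=> /subnK <-; elim: (n - m)%N => // k IH.
  by rewrite addSn; apply: subset_trans IH.
have /choice[k kP] : forall x : Z, exists n : nat, forall y : Z, y <> x ->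
    (diameter (B n) <= (mdist x y)%:E)%E.
  move=> x; have [d d0 dP] := hZ x.
  have : \forall n \near \oo, (diameter (B n) < d%:E)%E.
    (* The extended reals below [d] form a neighbourhood of 0. *)
    by apply: (hdiam [set u | (u < d%:E)%E]); apply: open_ereal_lt'; rewrite lte_fin.
  case=> n _ nP; exists n => y /dP dxy.
  by apply/ltW/(lt_trans (nP n (leqnn n))); rewrite lte_fin.
have [f [f_inj fB]] := injective_selection (fun x => hcard (k x)).
exists f; split=> //; exists 1 => // x y; rewrite mul1r.
(* The smaller index has the larger ball, which contains both images. *)
wlog kxy : x y / (k x <= k y)%N => [H|].
  have [/H//|/ltnW/H] := leqP (k x) (k y).
  by rewrite metric_sym [in leRHS]metric_sym.
have [->|/eqP yx] := eqVneq y x; first by rewrite !mdistxx.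
rewrite -lee_fin; apply: le_trans (kP x y yx).
by apply: mdist_le_diameter => //; exact: nested (fB y).
Qed.
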